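(* Let $d\ge2$ and let $Y_1,\ldots,Y_n$ be random vectors in $\mathbb{R}^d$ which are exchangeable and almost surely in type $A$ general position. Let $$\mathcal{G}_n^A:=\{v\in\mathbb{R}^d:\langle v,Y_1\rangle\le\cdots\le\langle v,Y_n\rangle\}.$$ Then the Weyl random cone $\mathcal{D}_n^A$ of type $A_{n-1}$ has the same distribution as $\mathcal{G}_n^A$ conditioned on the event $\mathcal{G}_n^A\ne\{0\}$.
   Context: Type $A$ general position: vectors $y_1,\ldots,y_n\in\mathbb{R}^d$ are said to be in type $A$ general position if $n\ge d+1$ and, for every permutation $\sigma$ of $\{1,\ldots,n\}$, any $d$ of the vectors $y_{\sigma(1)}-y_{\sigma(2)},\ldots,y_{\sigma(n-1)}-y_{\sigma(n)}$ are linearly independent. Exchangeable means that $(Y_1,\ldots,Y_n)$ has the same distribution as $(Y_{\sigma(1)},\ldots,Y_{\sigma(n)})$ for every permutation $\sigma$ of $\{1,\ldots,n\}$. For $x\in\mathbb{R}^d\setminus\{0\}$ let $x^\perp=\{v\in\mathbb{R}^d:\langle v,x\rangle=0\}$. The Weyl tessellation $\mathcal{W}^A(y_1,\ldots,y_n)$ of type $A_{n-1}$ is the set of cones obtained as closures of the connected components of $\mathbb{R}^d\setminus\bigcup_{1\le i<j\le n}(y_i-y_j)^\perp$. The Weyl random cone $\mathcal{D}_n^A$ is obtained by choosing uniformly at random one of the cones of the random tessellation $\mathcal{W}^A(Y_1,\ldots,Y_n)$; that is, for a Borel set $\mathcal{B}$ of polyhedral cones, $\mathbb{P}(\mathcal{D}_n^A\in\mathcal{B})=\mathbb{E}\big[\frac{1}{\#\mathcal{W}^A(Y_1,\ldots,Y_n)}\sum_{C\in\mathcal{W}^A(Y_1,\ldots,Y_n)}\mathbf{1}_{\mathcal{B}}(C)\big]$.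 *)

(* Defs.v *)
From HB Require Import structures.
From mathcomp Require Export all_boot all_order all_algebra all_fingroup.
From mathcomp Require Export finmap.
From mathcomp Require Export all_classical all_reals all_analysis.
Export Order.TTheory GRing.Theory Num.Theory.
Export numFieldNormedType.Exports.

Set Implicit Arguments.
Unset Strict Implicit.
Unset Printing Implicit Defensive.

Local Open Scope classical_set_scope.
Local Open Scope ring_scope.

Section euclidean.
Context {R : realType} {d : nat}.
Implicit Types (u v x : 'rV[R]_d) (A B : set 'rV[R]_d).

Definition inner u v : R := \sum_(k < d) u 0 k * v 0 k.

Definition enorm v : R := Num.sqrt (inner v v).

(* perp 0 is the whole space, so the tessellation below is empty when two of the
   vectors coincide; this does not happen in general position. *)
Definition perp x : set 'rV[R]_d := [set v | inner v x = 0].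

Definition unit_ball : set 'rV[R]_d := [set v | enorm v <= 1].

Definition dist_to v A : R := inf [set enorm (v - u) | u in A].

Definition hausdorff_dist A B : R :=
  Num.max (sup [set dist_to v B | v in A]) (sup [set dist_to v A | v in B]).

End euclidean.

Section polyhedral_cones.
Context (R : realType) (d : nat).
Implicit Types C D : set 'rV[R]_d.

Definition polyhedral_cone : set (set 'rV[R]_d) :=
  [set C | exists m (a : 'I_m -> 'rV[R]_d),
     C = [set v | forall i, inner v (a i) <= 0]].

(* Cones are unbounded, so they are compared inside the unit ball; this metric
   induces the usual topology on closed cones (that of the Hausdorff distance
   of their traces on the unit sphere, with {0} isolated), and {0} needs no
   special treatment. *)
Definition cone_dist C D : R :=
  hausdorff_dist (C `&` unit_ball) (D `&` unit_ball).

Definition open_cones : set (set (set 'rV[R]_d)) :=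
  [set U | U `<=` polyhedral_cone /\
     forall C, U C -> exists2 e : R, 0 < e &
       forall D, polyhedral_cone D -> cone_dist C D < e -> U D].

Definition borel_cones : set (set (set 'rV[R]_d)) :=
  <<s polyhedral_cone, open_cones>>.

End polyhedral_cones.

(* R^d with its Borel sigma-algebra *)
Notation borel_rV R d := (g_sigma_algebraType (@open 'rV[R]_d)).

Section weyl.
Context {R : realType} {d n : nat}.
Implicit Types y : 'I_n -> 'rV[R]_d.

Definition cur_idx (k : 'I_n.-1) : 'I_n := widen_ord (leq_pred n) k.

Lemma next_idx_subproof (k : 'I_n.-1) : (k.+1 < n)%N.
Proof. by rewrite -ltn_predRL. Qed.

Definition next_idx (k : 'I_n.-1) : 'I_n := Ordinal (next_idx_subproof k).

Definition typeA_general_position y : Prop :=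
  (d.+1 <= n)%N /\
  forall (s : 'S_n) (K : {set 'I_n.-1}), #|K| = d ->
    free [seq y (s (cur_idx k)) - y (s (next_idx k)) | k <- enum K].

Definition weyl_complement y : set 'rV[R]_d :=
  ~` (\bigcup_(p in [set p : 'I_n * 'I_n | (p.1 < p.2)%N])
        perp (y p.1 - y p.2)).

Definition weyl_tessellation y : set (set 'rV[R]_d) :=
  [set closure (connected_component (weyl_complement y) v)
     | v in weyl_complement y].

Definition weyl_coneG y : set 'rV[R]_d :=
  [set v | forall k : 'I_n.-1,
     inner v (y (cur_idx k)) <= inner v (y (next_idx k))].

End weyl.

Section laws.
Context d0 (T : measurableType d0) (R : realType) (P : probability T R).

Section vectors.
Context (d n : nat).

Definition joint (Y : 'I_n -> T -> borel_rV R d) (w : T) :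
  n.-tuple (borel_rV R d) := [tuple Y i w | i < n].

Definition exchangeable (Y : 'I_n -> {RV P >-> borel_rV R d}) : Prop :=
  forall (s : 'S_n) (A : set (n.-tuple (borel_rV R d))), measurable A ->
    P (joint (fun i => Y (s i)) @^-1` A) = P (joint (fun i => Y i) @^-1` A).

Definition weyl_random_cone_law (Y : 'I_n -> {RV P >-> borel_rV R d})
    (B : set (set 'rV[R]_d)) : \bar R :=
  'E_P[fun w : T =>
     let W := weyl_tessellation (fun i => Y i w : 'rV[R]_d) in
     (#|` fset_set W |%:R)^-1 * \sum_(C \in W) (\1_B C : R)].

End vectors.

Definition cond_law {E : Type} (X : T -> E) (F : set T) (B : set E) : \bar R :=
  (P (X @^-1` B `&` F) / P F)%E.

End laws.

(* Main.v *)
Require Import Defs.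
From mathcomp Require Import zify ring measurable_realfun.

(** For a permutation [s], consider the cone of the vectors [v] along which the
  numbers [inner v (y (s i))] are nondecreasing in [i]. In general position the
  cones of the tessellation are exactly those of these [n`!] cones that are not
  reduced to [0], and each of them comes from a single permutation
  ([weyl_tessellationE], [chamber_inj], [chamber_nontrivial]). So the sum over
  the tessellation of the indicator of [B] is a sum over all permutations of the
  indicator of the event that the cone of [s] is nontrivial and belongs to [B].
  By exchangeability these [n`!] events have the same probability as the one for
  the identity, which is the event that [G] is nontrivial and belongs to [B]
  ([integral_symmetrized]).

  It remains to take the factor [1 / #W] out of the expectation, which is
  possible because the number of cones is the same for all configurations in
  general position ([card_cells]). The orderings induced by linear forms are
  counted by adding the points one at a time. A new point [a] adds the
  hyperplanes where it ties with an earlier point [b]; inside the cell of a given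
  ordering of the earlier points the possible positions of [a] form an interval,
  and consecutive positions are separated by exactly one of these hyperplanes, so
  the cell is cut into one more piece than there are hyperplanes crossing it. On
  the hyperplane where [a] and [b] tie the remaining arrangement is that of the
  earlier points in dimension one less, again in general position. This gives the
  recursion of [region_count] ([num_induced_cons], [num_inducedE]). The case where
  [B] contains all cones then shows that [G] is nontrivial with probability the
  number of cones over [n`!] ([prob_nontrivial]), which is the normalization of
  the conditional law.

  For the probabilities to make sense the events must be measurable. A cone cut
  out by random inequalities meets a fixed compact set on a measurable event
  ([measurable_hitting]), and every open set of cones is a countable union of
  sets described by finitely many such conditions ([open_cones_network]). *)

Set Implicit Arguments.
Unset Strict Implicit.
Unset Printing Implicit Defensive.

Local Open Scope classical_set_scope.
Local Open Scope ring_scope.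

(** * The inner product *)

Section inner_product.
Context {R : realType} {d : nat}.
Implicit Types (u v x : 'rV[R]_d) (S : {vspace 'rV[R]_d}).

Lemma innerC u v : inner u v = inner v u.
Proof. by apply: eq_bigr => k _; rewrite mulrC. Qed.

Lemma innerDl u v x : inner (u + v) x = inner u x + inner v x.
Proof. by rewrite /inner -big_split; apply: eq_bigr => k _; rewrite mxE mulrDl. Qed.

Lemma innerZl (c : R) u x : inner (c *: u) x = c * inner u x.
Proof. by rewrite /inner mulr_sumr; apply: eq_bigr => k _; rewrite mxE mulrA. Qed.

Lemma innerDr x u v : inner x (u + v) = inner x u + inner x v.
Proof. by rewrite innerC innerDl !(innerC x). Qed.

Lemma innerZr (c : R) x u : inner x (c *: u) = c * inner x u.
Proof. by rewrite innerC innerZl (innerC x). Qed.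

Lemma innerBr x u v : inner x (u - v) = inner x u - inner x v.
Proof. by rewrite innerDr -scaleN1r innerZr mulN1r. Qed.

Lemma inner0l x : inner 0 x = 0.
Proof. by rewrite -(scale0r 0) innerZl mul0r. Qed.

Lemma inner_delta v (k : 'I_d) : inner v (delta_mx 0 k) = v 0 k.
Proof.
rewrite /inner (bigD1 k)//= mxE !eqxx mulr1 big1 ?addr0// => j jk.
by rewrite mxE (negbTE jk) andbF mulr0.
Qed.

(** Projecting along [S] gives a linear map that kills [S] but not [e]; a
  coordinate of it that does not vanish at [e] is an inner product. *)
Lemma orthogonal_separation S e : e \notin S ->
  exists2 u, (forall x, x \in S -> inner u x = 0) & inner u e != 0.
Proof.
move=> eS; pose p := (\1 - projv S)%VF.
have pE x : p x = x - projv S x by rewrite lfunE/= opp_lfunE id_lfunE.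
have /rV0Pn[k pk] : p e != 0.
  by apply: contra eS; rewrite pE subr_eq0 => /eqP ->; exact: memv_proj.
pose u := \row_j (p (delta_mx 0 j)) 0 k.
have uE x : inner u x = (p x) 0 k.
  rewrite {2}(row_sum_delta x) linear_sum summxE; apply: eq_bigr => j _.
  by rewrite linearZ !mxE mulrC.
exists u; last by rewrite uE.
by move=> x xS; rewrite uE pE projv_id// subrr mxE.
Qed.

(** The first-order move [u] settles the inequalities that are tight at [v],
  and a small multiple of it does not disturb the strict ones. *)
Lemma perturbation v u (xs : seq 'rV[R]_d) :
  {in xs, forall x, inner v x < 0 \/ inner v x = 0 /\ inner u x < 0} ->
  exists2 e : R, 0 < e & {in xs, forall x, inner (v + e *: u) x < 0}.
Proof.
move=> H.
suff [e e0 He] : exists2 e : R, 0 < e & forall c : R, 0 < c <= e ->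
    {in xs, forall x, inner (v + c *: u) x < 0}.
  by exists e => //; apply: He; rewrite e0 lexx.
elim: xs H => [|x xs IH] H; first by exists 1.
have [z zs|e e0 He] := IH; first by apply: H; rewrite inE zs orbT.
have [f f0 Hf] : exists2 f : R, 0 < f & forall c, 0 < c <= f ->
    inner (v + c *: u) x < 0.
  have [vx|[vx ux]] := H x (mem_head _ _); last first.
    exists 1 => // c /andP[c0 _].
    by rewrite innerDl innerZl vx add0r pmulr_rlt0.
  exists (- inner v x / (`|inner u x| + 1)).
    by rewrite divr_gt0 ?oppr_gt0// ltr_wpDl.
  move=> c /andP[c0]; rewrite ler_pdivlMr ?ltr_wpDl// mulrDr mulr1 => cle.
  rewrite innerDl innerZl addrC -ltrBrDr sub0r (lt_le_trans _ cle)//.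
  by rewrite (le_lt_trans (ler_norm _))// normrM (gtr0_norm c0) ltrDl.
exists (Num.min e f) => [|c /andP[c0]]; first by rewrite lt_min e0.
rewrite le_min => /andP[ce cf] z; rewrite inE => /predU1P[->|zs].
  by apply: Hf; rewrite c0.
by apply: He; rewrite ?c0.
Qed.

End inner_product.

(** * Orderings of points induced by a linear form *)

Section orderings.
Context {R : realType} {d : nat} {I : eqType} (y : I -> 'rV[R]_d).
Implicit Types (u v : 'rV[R]_d) (S : {vspace 'rV[R]_d}) (t L : seq I) (a b : I).

Definition steps t := if t is i :: t' then pairmap (fun a b => y a - y b) i t'
                      else [::].

Definition below v : rel I := fun i j => inner v (y i - y j) < 0.

(** General position of the traces of the hyperplanes orthogonal to [y i - y j]
  on the orthogonal complement of [S]. Keeping [S] as a parameter, rather than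
  projecting the points to a space of smaller dimension, is what makes the
  induction on the dimension free of coordinates. *)
Definition general_relative S L := forall t xs, perm_eq t L ->
  subseq xs (steps t) -> (\dim S + size xs <= d)%N ->
  \dim (S + <<xs>>)%VS = (\dim S + size xs)%N.

(** The cell of the ordering [t] meets the orthogonal complement of [S]. *)
Definition induced S t := `[< exists2 v : 'rV[R]_d,
  forall u, u \in S -> inner v u = 0 & sorted (below v) t >].

Definition num_induced S L := (\sum_(t <- permutations L) induced S t)%N.

Definition insert a p t := take p t ++ a :: drop p t.

Lemma sorted_steps (p : pred 'rV[R]_d) t :
  sorted (fun i j => p (y i - y j)) t = all p (steps t).
Proof. by case: t => //= i t; elim: t i => //= j t IH i; rewrite IH. Qed.

Lemma below_trans v : transitive (below v).
Proof.
move=> j i k; rewrite /below !innerBr !subr_lt0; exact: lt_trans.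
Qed.

Lemma steps_cat t1 b t2 :
  steps (t1 ++ b :: t2) = steps (rcons t1 b) ++ steps (b :: t2).
Proof. by case: t1 => //= i t1; rewrite -cats1 !pairmap_cat -catA. Qed.

Lemma induced_subseq S t1 t2 : subseq t1 t2 -> induced S t2 -> induced S t1.
Proof.
move=> t12 /asboolP[v vS vt]; apply/asboolP; exists v => //.
exact: (subseq_sorted (@below_trans v) t12).
Qed.

Lemma orthogonal_line S e v : (forall x, x \in S -> inner v x = 0) ->
  inner v e = 0 -> forall x, x \in (S + <[e]>)%VS -> inner v x = 0.
Proof.
move=> vS ve x /memv_addP[s /vS vs [z /vlineP[c ->] ->]].
by rewrite innerDr innerZr ve vs mulr0 addr0.
Qed.

Lemma general_behead S a L : general_relative S (a :: L) -> general_relative S L.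
Proof.
move=> gen t xs tL sub; apply: (gen (rcons t a)).
  by rewrite perm_rcons perm_cons.
apply: (subseq_trans sub); case: t {tL sub} => //= i t.
by rewrite -cats1 pairmap_cat prefix_subseq.
Qed.

Lemma general_dim S a b L : general_relative S (a :: L) -> b \in L ->
  (\dim S < d)%N -> \dim (S + <[y b - y a]>) = (\dim S).+1.
Proof.
move=> gen bL dS; have := gen (b :: a :: rem b L) [:: y b - y a].
rewrite (perm_catCA [:: b] [:: a]) perm_cons perm_sym perm_to_rem//.
by rewrite sub1seq inE eqxx span_seq1 addn1 => /(_ isT isT dS).
Qed.

Lemma general_step S a b L : general_relative S (a :: L) -> b \in L ->
  (\dim S < d)%N -> y b - y a \notin S.
Proof.
move=> gen bL dS; apply/negP => bS.
have : (\dim (S + <[y b - y a]>) <= \dim S)%N.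
  by rewrite dimvS// subv_add subvv.
by rewrite (general_dim gen bL dS) ltnn.
Qed.

Lemma subseq_catE (T : eqType) (xs s1 s2 : seq T) : subseq xs (s1 ++ s2) ->
  exists x1 x2, [/\ xs = x1 ++ x2, subseq x1 s1 & subseq x2 s2].
Proof.
move=> /subseqP[m sm ->].
have st : size (take (size s1) m) = size s1.
  by rewrite size_take sm size_cat; case: ltngtP => //; lia.
rewrite -(cat_take_drop (size s1) m) mask_cat//.
by do 2 eexists; split; [reflexivity|exact: mask_subseq..].
Qed.

(** Placing [a] right after [b] in an ordering of [L] turns the steps of that
  ordering, taken modulo [y b - y a], into steps of an ordering of [a :: L]. *)
Lemma general_restrict S a b L : general_relative S (a :: L) -> b \in L ->
  (\dim S < d)%N -> general_relative (S + <[y b - y a]>) L.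
Proof.
move=> gen bL dS t xs tL sub.
rewrite (general_dim gen bL dS) addSnnS => le_d.
have bt : b \in t by rewrite (perm_mem tL).
case/splitPr: bt tL sub => t1 t2 tL.
rewrite steps_cat => /subseq_catE[x1 [x2 [xsE sub1 sub2]]].
(* Only the step that leaves [b] changes: it now leaves [a], and the two
  differ by [y b - y a]. *)
suff [x2' [sub2' sz2 span2]] : exists x2', [/\ subseq x2' (steps (a :: t2)),
    size x2' = size x2 &
    (<[y b - y a]> + <<x2'>> = <[y b - y a]> + <<x2>>)%VS].
  have := gen (t1 ++ b :: a :: t2) (x1 ++ (y b - y a) :: x2').
  have -> : (S + <[y b - y a]> + <<xs>> = S + <<x1 ++ (y b - y a) :: x2'>>)%VS.
    rewrite xsE !span_cat span_cons span2 -!addvA; congr (_ + _)%VS.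
    by rewrite !addvA (addvC <[_]>%VS).
  have -> : size (x1 ++ (y b - y a) :: x2') = (size xs).+1.
    by rewrite xsE !size_cat/= sz2 addnS.
  apply => //.
    rewrite -cat_rcons (perm_catCA (rcons t1 b) [:: a] t2) perm_cons.
    by rewrite cat_rcons.
  rewrite steps_cat cat_subseq//=.
  by case: (t2) sub2' => [/=|c t3]; rewrite eqxx.
case: t2 tL sub2 => [_|c t2 _].
  by rewrite [steps _]/= subseq0 => /eqP ->; exists [::].
case: x2 xsE => [|z x2] xsE; first by exists [::]; rewrite sub0seq.
rewrite /=; have [->|_] := eqVneq z (y b - y c); last first.
  move=> sub2; exists (z :: x2); split => //.
  exact: (subseq_trans sub2 (subseq_cons _ _)).
move=> sub2; exists ((y a - y c) :: x2); rewrite eqxx; split => //.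
rewrite !span_cons !addvA; congr (_ + _)%VS; apply/eqP; rewrite eqEsubv.
have acE : y a - y c = (y b - y c) - (y b - y a).
  by rewrite [RHS]addrC opprB addrA subrK.
have bcE : y b - y c = (y b - y a) + (y a - y c) by rewrite addrA subrK.
rewrite !subv_add !addvSl/= -!memvE; apply/andP; split.
  by rewrite acE addrC memv_add// ?rpredN memv_line.
by rewrite bcE memv_add// memv_line.
Qed.

Lemma sorted_insert (r : rel I) a t1 t2 : transitive r ->
  sorted r (t1 ++ a :: t2) =
  [&& sorted r (t1 ++ t2), all (r^~ a) t1 & all (r a) t2].
Proof.
move=> tr; rewrite !sorted_pairwise// !pairwise_cat/= allrel_consr.
by case: all; case: all; rewrite ?andbF ?andbT.
Qed.

Lemma below_comb (c1 c2 : R) v1 v2 t : 0 < c1 -> 0 < c2 ->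
  sorted (below v1) t -> sorted (below v2) t ->
  sorted (below (c1 *: v1 + c2 *: v2)) t.
Proof.
move=> c1_gt0 c2_gt0.
rewrite 3!(sorted_steps (fun x => inner _ x < 0)) => /allP h1 /allP h2.
apply/allP => x xt; rewrite innerDl !innerZl.
by rewrite -oppr_gt0 opprD addr_gt0// oppr_gt0 pmulr_rlt0// ?h1 ?h2.
Qed.

(** Two vectors of the cell of [t] that see [a] on different sides of [b] have
  a positive combination, still in that cell, on which [a] and [b] tie. *)
Lemma induced_between S a b t1 t2 t3 :
  induced S (t1 ++ a :: t2 ++ b :: t3) -> forall s1 s2,
  s1 ++ s2 = t1 ++ t2 ++ b :: t3 -> b \in s1 -> induced S (s1 ++ a :: s2) ->
  induced (S + <[y b - y a]>) (t1 ++ t2 ++ b :: t3).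
Proof.
move=> /asboolP[v vS]; rewrite sorted_insert; last exact: below_trans.
rewrite all_cat /= => /and4P[vt _ _ /andP[vab _]] s1 s2 sE bs1 /asboolP[w wS].
rewrite sorted_insert; last exact: below_trans.
rewrite sE => /and3P[wt /allP/(_ _ bs1) wba _].
have {}wba : 0 < inner w (y a - y b).
  by rewrite -opprB -scaleN1r innerZr mulN1r oppr_gt0.
rewrite /below -oppr_gt0 in vab.
apply/asboolP.
exists (inner w (y a - y b) *: v + (- inner v (y a - y b)) *: w).
  apply: orthogonal_line => [x xS|].
    by rewrite innerDl !innerZl (vS _ xS) (wS _ xS) !mulr0 addr0.
  by rewrite innerDl !innerZl !innerBr; ring.
exact: below_comb.
Qed.

(** From a point of the cell of [t1 ++ b :: t2] where [a] and [b] tie, a small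
  step along [u] or [- u] breaks the tie in favour of either. Such a [u]
  orthogonal to [S] exists because [y b - y a] is not in [S]. *)
Lemma induced_tie S a b t1 t2 L : general_relative S (a :: L) ->
  (\dim S < d)%N -> perm_eq (t1 ++ b :: t2) L ->
  induced (S + <[y b - y a]>) (t1 ++ b :: t2) =
  induced S (t1 ++ a :: b :: t2) && induced S (t1 ++ b :: a :: t2).
Proof.
move=> gen dS tL; apply/idP/andP => [/asboolP[v vS vt]|[t1a t1b]]; last first.
  apply: (induced_between (t2 := [::]) t1a (s1 := rcons t1 b)).
  - by rewrite cat_rcons.
  - by rewrite mem_rcons mem_head.
  - by rewrite cat_rcons.
have bL : b \in L by rewrite -(perm_mem tL) mem_cat mem_head orbT.
have [u uS u0] := orthogonal_separation (general_step gen bL dS).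
have vSS x : x \in S -> inner v x = 0.
  by move=> xS; apply: vS; apply: (subvP (addvSl _ _)).
have vab : inner v (y b - y a) = 0.
  by apply: vS; apply: (subvP (addvSr _ _)); exact: memv_line.
have {}vab : inner v (y a) = inner v (y b).
  by apply/esym/eqP; rewrite -subr_eq0 -innerBr vab.
(* The order seen from [v + e *: w] for all small positive [e]. *)
pose lex w : rel I := fun i j => (inner v (y i - y j) < 0) ||
  ((inner v (y i - y j) == 0) && (inner w (y i - y j) < 0)).
have lex_trans w : transitive (lex w).
  move=> j i k; rewrite /lex !innerBr !subr_lt0 !subr_eq0.
  move=> /orP[h1|/andP[/eqP -> h2]] /orP[h3|/andP[/eqP h3 h4]].
  - by rewrite (lt_trans h1 h3).
  - by rewrite -h3 h1.
  - by rewrite h3.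
  - by rewrite h3 eqxx (lt_trans h2 h4) orbT.
have induced_lex w t : (forall x, x \in S -> inner w x = 0) ->
    sorted (lex w) t -> induced S t.
  move=> wS; rewrite (sorted_steps (fun x => (inner v x < 0) ||
    ((inner v x == 0) && (inner w x < 0)))) => /allP h.
  have [|e _ he] := @perturbation _ _ v w (steps t).
    by move=> x /h /orP[?|/andP[/eqP ? ?]]; [left|right].
  apply/asboolP; exists (v + e *: w).
    by move=> x xS; rewrite innerDl innerZl vSS// wS// mulr0 addr0.
  by rewrite (sorted_steps (fun x => inner _ x < 0)); apply/allP.
have lexW w : subrel (below v) (lex w).
  by rewrite /lex /below => i j ->.
have lex_t w : sorted (lex w) (t1 ++ b :: t2).
  exact: sub_sorted vt.
move: vt; rewrite sorted_insert; last exact: below_trans.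
case/and3P => _ /allP vt1 /allP vt2.
have lex_t1 w : all ((lex w)^~ a) t1.
  by apply/allP => i /vt1; rewrite /lex /below !innerBr vab => ->.
have lex_t2 w : all (lex w a) t2.
  by apply/allP => i /vt2; rewrite /lex /below !innerBr vab => ->.
have lex_ab w : inner w (y a - y b) < 0 -> lex w a b.
  by rewrite /lex !innerBr vab subrr ltxx eqxx.
have lex_ba w : 0 < inner w (y a - y b) -> lex w b a.
  by rewrite /lex !innerBr vab subrr ltxx eqxx/= subr_gt0 subr_lt0.
have sort_ab w : inner w (y a - y b) < 0 -> sorted (lex w) (t1 ++ a :: b :: t2).
  by move=> wab; rewrite sorted_insert//= lex_t lex_t1 lex_t2 lex_ab.
have sort_ba w : 0 < inner w (y a - y b) -> sorted (lex w) (t1 ++ b :: a :: t2).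
  move=> wab; rewrite -cat_rcons sorted_insert//= cat_rcons lex_t lex_t2.
  by rewrite all_rcons lex_t1 lex_ba.
have uSN x : x \in S -> inner (- u) x = 0.
  by move=> xS; rewrite -scaleN1r innerZl uS// mulr0.
have uN x : inner (- u) x = - inner u x by rewrite -scaleN1r innerZl mulN1r.
have [|] := ltrP 0 (inner u (y a - y b)) => uab.
  split; [apply: (induced_lex (- u)) => //; apply: sort_ab|
          apply: (induced_lex u) => //; exact: sort_ba].
  by rewrite uN oppr_lt0.
have {}uab : inner u (y a - y b) < 0.
  rewrite lt_neqAle uab andbT; apply: contra u0.
  by rewrite !innerBr !subr_eq0 eq_sym.
split; [apply: (induced_lex u) => //; exact: sort_ab|
        apply: (induced_lex (- u)) => //; apply: sort_ba].
by rewrite uN oppr_gt0.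
Qed.

Lemma induced_wall S a t L r : general_relative S (a :: L) ->
  (\dim S < d)%N -> perm_eq t L -> (r < size t)%N ->
  induced (S + <[y (nth a t r) - y a]>) t =
  induced S (insert a r t) && induced S (insert a r.+1 t).
Proof.
move=> gen dS tL rt.
have tE : take r t ++ nth a t r :: drop r.+1 t = t.
  by rewrite -drop_nth// cat_take_drop.
rewrite -[X in induced (S + _) X]tE (induced_tie gen) ?tE//.
by rewrite /insert (take_nth a)// cat_rcons (drop_nth a rt).
Qed.

Lemma induced_convex S a t L p r q : general_relative S (a :: L) ->
  (\dim S < d)%N -> perm_eq t L -> (p <= r < q)%N -> (q <= size t)%N ->
  induced S (insert a p t) -> induced S (insert a q t) ->
  induced S (insert a r t) && induced S (insert a r.+1 t).
Proof.
move=> gen dS tL /andP[pr rq] qt tp tq.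
have rt : (r < size t)%N by apply: leq_trans qt.
rewrite -(induced_wall gen)//.
have dropE : drop p t = take (r - p) (drop p t) ++ nth a t r :: drop r.+1 t.
  by rewrite -drop_nth// -{2}(subnK pr) -drop_drop cat_take_drop.
rewrite -[t in induced _ t](cat_take_drop p) dropE.
apply: (@induced_between _ _ _ _ _ _ _ (take q t) (drop q t)).
- by rewrite -dropE.
- by rewrite -dropE !cat_take_drop.
- by rewrite -(nth_take a rq) mem_nth// size_takel.
- exact: tq.
Qed.

(** Within the cell of [t] the label [a] can always be placed; if its value ties
  with that of another label, the tie can be broken. *)
Lemma induced_insert S a t L : general_relative S (a :: L) ->
  (\dim S < d)%N -> perm_eq t L -> induced S t ->
  has (fun p => induced S (insert a p t)) (iota 0 (size t).+1).
Proof.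
move=> gen dS tL /asboolP[v vS vt].
pose p := find (fun b => inner v (y a) <= inner v (y b)) t.
have pt : (p <= size t)%N by exact: find_size.
apply/hasP; exists p; first by rewrite mem_iota.
have before : all ((below v)^~ a) (take p t).
  apply/allP => b /(nthP a)[k]; rewrite size_takel// => kp <-.
  rewrite nth_take// /below innerBr subr_lt0 ltNge.
  by rewrite (before_find a kp).
have [pE|pt'] := eqVneq p (size t).
  apply/asboolP; exists v => //; rewrite sorted_insert; last exact: below_trans.
  by rewrite cat_take_drop vt before pE drop_size.
have {pt'}pt' : (p < size t)%N by rewrite ltn_neqAle pt'.
have pa : inner v (y a) <= inner v (y (nth a t p)).
  have : has (fun b => inner v (y a) <= inner v (y b)) t by rewrite has_find.
  exact: nth_find.
have [ab|ab] := eqVneq (inner v (y a)) (inner v (y (nth a t p))).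
  suff : induced (S + <[y (nth a t p) - y a]>) t.
    by rewrite (induced_wall gen)// => /andP[].
  apply/asboolP; exists v => //; apply: orthogonal_line => //.
  by rewrite innerBr ab subrr.
apply/asboolP; exists v => //; rewrite sorted_insert; last exact: below_trans.
rewrite cat_take_drop vt before/= (drop_nth a)//=.
have {ab}ab : below v a (nth a t p).
  by rewrite /below innerBr subr_lt0 lt_neqAle ab.
rewrite ab /=; apply/allP => c ct; apply: (below_trans ab).
move: vt; rewrite -{1}(cat_take_drop p t) (drop_nth a)//.
rewrite sorted_insert; last exact: below_trans.
by case/and3P => _ _ /allP/(_ _ ct).
Qed.

End orderings.

(** * Counting induced orderings *)

(** Among the positions satisfying [P], an interval, each but the last is
  followed by another one. *)
Lemma count_convex (P : pred nat) n :
  (forall p r q, (p <= r < q)%N -> (q <= n)%N -> P p -> P q -> P r) ->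
  (\sum_(r < n.+1) P r = has P (iota 0 n.+1) + \sum_(r < n) (P r && P r.+1))%N.
Proof.
have [E EE] : exists E : nat -> bool, forall m, has P (iota 0 m) = E m.
  by exists (fun m => has P (iota 0 m)).
have ES m : E m.+1 = E m || P m.
  by rewrite -!EE -(addn1 m) iotaD has_cat /= orbF.
rewrite EE; elim: n => [|n IH] cvx.
  by rewrite big_ord1 big_ord0 ES -EE addn0.
rewrite big_ord_recr/= IH => [|p r q prq qn]; last first.
  by apply: cvx prq _; exact: leqW.
rewrite [in RHS]big_ord_recr/= (ES n.+1).
have [Pn1|Pn1] := boolP (P n.+1); last by rewrite orbF andbF !addn0.
rewrite orbT andbT; suff -> : E n.+1 = P n by lia.
rewrite -EE; apply/hasP/idP => [[p]|Pn]; last by exists n; rewrite // mem_iota/=.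
rewrite mem_iota /= add0n => pn Pp; apply: cvx Pp Pn1; last by [].
by rewrite -ltnS pn /=.
Qed.

(** The number of chambers cut out in dimension [m] by the hyperplanes
  orthogonal to the differences of [n] points in general position. *)
Fixpoint region_count m n := if n is n'.+1 then
  if m is m'.+1 then (region_count m n' + n' * region_count m' n')%N
  else nat_of_bool (n' == 0%N) else 1%N.

Lemma region_count_gt0 m n : (0 < region_count m.+1 n)%N.
Proof. by elim: n => //= n IH; rewrite ltn_addr. Qed.

Lemma permutations_insert (I : eqType) (a : I) L : uniq (a :: L) ->
  perm_eq (permutations (a :: L))
    [seq insert a p t | t <- permutations L, p <- iota 0 (size L).+1].
Proof.
move=> uaL; have /andP[aL uL] := uaL.
have at_ t : t \in permutations L -> a \notin t.
  by rewrite mem_permutations => /perm_mem ->.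
have indexE p t : a \notin t -> (p <= size t)%N -> index a (insert a p t) = p.
  move=> nt pt; rewrite index_cat ifN /= ?eqxx ?addn0 ?size_takel//.
  by apply: contra nt => /mem_take.
have remE p t : a \notin t -> rem a (insert a p t) = t.
  move=> nt; rewrite -[RHS](cat_take_drop p t) /insert.
  have : a \notin take p t by apply: contra nt => /mem_take.
  by elim: (take p t) => /= [|c s IH]; rewrite ?eqxx// inE negb_or eq_sym
    => /andP[/negbTE -> /IH ->].
apply: uniq_perm; first exact: permutations_uniq.
  refine (@allpairs_uniq (seq I) nat (seq I) (fun t p => insert a p t) _ _ _ _ _);
    [exact: permutations_uniq|exact: iota_uniq|].
  move=> x x' /flatten_mapP[t1 tL /mapP[p1 pL ->]].
  move=> /flatten_mapP[t2 tL' /mapP[p2 pL' ->]] /= E.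
  have szt s : s \in permutations L -> size s = size L.
    by rewrite mem_permutations => /perm_size.
  move: pL pL'; rewrite !mem_iota !add0n !ltnS -(szt _ tL) => p1t p2t.
  have t12 : t1 = t2 by rewrite -(remE p1 t1) ?at_// E remE ?at_.
  rewrite -t12 in E; rewrite -t12 -(indexE p1 t1) ?at_// E indexE ?at_//.
move=> t; rewrite mem_permutations; apply/idP/allpairsP.
  move=> taL; have a_t : a \in t by rewrite (perm_mem taL) mem_head.
  case/splitPr: a_t taL => t1 t2 taL.
  have tL : perm_eq (t1 ++ t2) L.
    by move: taL; rewrite (perm_catCA t1 [:: a] t2) perm_cons.
  exists (t1 ++ t2, size t1); split.
  - by rewrite mem_permutations.
  - rewrite [_.2]/= mem_iota -(perm_size tL) size_cat; lia.
  - by rewrite /insert take_size_cat// drop_size_cat.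
move=> [[s p] [/= sL _ ->]]; rewrite /insert (perm_catCA _ [:: a]) perm_cons.
by rewrite cat_take_drop -mem_permutations.
Qed.

Section counting.
Context {R : realType} {d : nat} {I : eqType} (y : I -> 'rV[R]_d).
Implicit Types (S : {vspace 'rV[R]_d}) (a : I) (L : seq I).

(** The places for [a] in the cell of [t] form an interval, and two consecutive
  ones are separated by exactly one of the hyperplanes orthogonal to the
  [y b - y a] that cross the cell. *)
Lemma num_insertions S a t L : general_relative y S (a :: L) ->
  (\dim S < d)%N -> perm_eq t L ->
  (\sum_(p <- iota 0 (size L).+1) induced y S (insert a p t) =
   induced y S t + \sum_(b <- L) induced y (S + <[y b - y a]>) t)%N.
Proof.
move=> gen dS tL; rewrite -(perm_size tL) -(perm_big _ tL).
rewrite -[iota _ _]/(index_iota 0 (size t).+1) big_mkord.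
rewrite (@count_convex (fun p => induced y S (insert a p t))); last first.
  move=> p r q prq qt tp tq.
  by have /andP[] := induced_convex gen dS tL prq qt tp tq.
congr (_ + _)%N.
  congr nat_of_bool; apply/idP/idP; last exact: induced_insert gen dS tL.
  move=> /hasP[p _]; apply: induced_subseq; rewrite /insert.
  by rewrite -{1}(cat_take_drop p t) cat_subseq// subseq_cons.
rewrite (big_nth a) big_mkord; apply: eq_bigr => r _.
by rewrite (induced_wall gen).
Qed.

(** Deletion and restriction: the cells of [a :: L] are those of [L], cut by the
  hyperplanes orthogonal to [y b - y a], and on each such hyperplane the labels
  [a] and [b] merge, which leaves the arrangement of [L] in one dimension
  less. *)
Lemma num_induced_cons S a L : uniq (a :: L) ->
  general_relative y S (a :: L) -> (\dim S < d)%N ->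
  num_induced y S (a :: L) =
  (num_induced y S L + \sum_(b <- L) num_induced y (S + <[y b - y a]>) L)%N.
Proof.
move=> uaL gen dS; rewrite /num_induced (perm_big _ (permutations_insert uaL)).
rewrite big_allpairs_dep [X in (_ + X)%N]exchange_big -big_split/= !big_seq.
apply: eq_bigr => t.
by rewrite mem_permutations; exact: num_insertions.
Qed.

(** Both terms of [num_induced_cons] concern fewer labels in general position,
  so by induction the number of cells depends only on the number of points and
  the dimension. In dimension [0] two labels always tie. *)
Lemma num_inducedE S L : uniq L -> general_relative y S L ->
  num_induced y S L = region_count (d - \dim S) (size L).
Proof.
elim: L S => [|a L IH] S uL gen.
  rewrite /num_induced; have -> : permutations [::] = [:: [::]] :> seq (seq I) by [].
  rewrite big_seq1; suff -> : induced y S [::] by case: (d - _)%N.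
  by apply/asboolP; exists 0 => // u _; rewrite inner0l.
have [_ uL'] := andP uL.
have := dimvS (subvf S); rewrite dimvf/= /dim/= mul1n => dS.
have [dlt|dge] := ltnP (\dim S) d; last first.
  have SE : S = fullv.
    by apply/eqP; rewrite eqEdim subvf dimvf /dim/= mul1n.
  have {dge}-> : (d - \dim S = 0)%N by lia.
  rewrite /num_induced; case: L {IH gen} uL uL' => [|b L] uL uL'.
    have -> : permutations [:: a] = [:: [:: a]] by [].
    rewrite big_seq1; suff -> : induced y S [:: a] by [].
    by apply/asboolP; exists 0 => // u _; rewrite inner0l.
  rewrite big_seq big1//= => t; rewrite mem_permutations => /perm_size.
  case: t => [|i [|j t]]// _; apply/eqP; rewrite eqb0; apply/asboolP.
  move=> [v vS /= /andP[+ _]]; rewrite /below vS ?ltxx//.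
  by rewrite SE memvf.
rewrite num_induced_cons// IH//; last exact: general_behead gen.
have -> : (d - \dim S = (d - (\dim S).+1).+1)%N by lia.
rewrite /=; congr (_ + _)%N.
rewrite big_seq (eq_bigr (fun=> region_count (d - (\dim S).+1) (size L))).
  by rewrite -big_seq big_const_seq count_predT iter_addn_0 mulnC.
move=> b bL; rewrite IH//; last exact: general_restrict gen bL dlt.
congr (region_count (d - _)%N _).
exact: general_dim gen bL dlt.
Qed.

End counting.

(** * Connectedness and continuity *)

Section topology.
Context {R : realType} {d : nat}.
Implicit Types (u v x : 'rV[R]_d) (A D : set 'rV[R]_d).

Lemma inner_continuous x : continuous (inner ^~ x : 'rV[R]_d -> R).
Proof.
move=> v; apply: (continuous_big (op := +%R)).
  exact: add_continuous.
move=> k _ w; apply: continuousM; last exact: cst_continuous.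
exact: coord_continuous.
Qed.

Lemma convex_connected A :
  (forall u v (c : R), A u -> A v -> 0 <= c <= 1 -> A (u + c *: (v - u))) ->
  connected A.
Proof.
move=> cvx; have [->|/set0P[u Au]] := eqVneq A set0; first exact: connected0.
have -> : A = \bigcup_(v in A) ((fun c : R => u + c *: (v - u)) @` `[0, 1]).
  apply/seteqP; split=> [v Av|_ [v Av] [c /= c01 <-]].
    exists v => //=; exists 1; last by rewrite scale1r addrC subrK.
    by rewrite /= in_itv/= ler01 lexx.
  by apply: cvx => //; move: c01; rewrite in_itv.
apply: bigcup_connected.
  exists u => v Av; exists 0; last by rewrite scale0r addr0.
  by rewrite /= in_itv/= lexx ler01.
move=> v _; apply: connected_continuous_connected.
  exact: segment_connected.
apply: continuous_subspaceT => c.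
apply: (@cvgD R 'rV[R]_d); first exact: cvg_cst.
exact: (@scalel_continuous R 'rV[R]_d).
Qed.

End topology.

(** * Cells and chambers of the arrangement *)

Section weyl_cones.
Context {R : realType} {d n : nat} (y : 'I_n -> 'rV[R]_d).
Implicit Types (u v w x : 'rV[R]_d) (s : 'S_n).

Definition word s : seq 'I_n := [seq s i | i <- enum 'I_n].

Definition open_cell s : set 'rV[R]_d := [set v | sorted (below y v) (word s)].

Definition chamber s : set 'rV[R]_d := weyl_coneG (fun i => y (s i)).

Lemma word_uniq s : uniq (word s).
Proof. by rewrite map_inj_uniq ?enum_uniq//; exact: perm_inj. Qed.

Lemma mem_word s i : i \in word s.
Proof.
by apply/mapP; exists (s^-1%g i); rewrite ?mem_enum//= permKV.
Qed.

Lemma word_perm s : perm_eq (word s) (enum 'I_n).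
Proof.
apply: uniq_perm; [exact: word_uniq|exact: enum_uniq|move=> i].
by rewrite mem_word mem_enum.
Qed.

Lemma word_inj : injective word.
Proof.
by move=> s s' /eq_in_map E; apply/permP => i; apply: E; rewrite mem_enum.
Qed.

Lemma wordP t : perm_eq t (enum 'I_n) -> exists s, word s = t.
Proof.
move=> tE; have sz : size t = n by rewrite (perm_size tE) size_enum_ord.
have ut : uniq t by rewrite (perm_uniq tE) enum_uniq.
pose T := tcast sz (in_tuple t).
have T_inj : injective (tnth T) by apply/tuple_uniqP; rewrite val_tcast.
exists (perm T_inj); rewrite /word (eq_map (permE T_inj)) map_tnth_enum.
by rewrite val_tcast.
Qed.

(** This matches the steps of an ordering with the consecutive differences
  that define cones and general position. *)
Lemma steps_word s :
  steps y (word s) = [seq y (s (cur_idx k)) - y (s (next_idx k)) | k <- enum 'I_n.-1].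
Proof.
have szw : size (word s) = n by rewrite size_map size_enum_ord.
have szs : size (steps y (word s)) = n.-1.
  by rewrite -[in RHS]szw; case: word => //= i t; rewrite size_pairmap.
apply: (@eq_from_nth _ 0) => [|k]; first by rewrite size_map size_enum_ord.
rewrite szs => kn; pose k' := Ordinal kn.
rewrite (nth_map k') ?size_enum_ord//.
have -> : nth k' (enum 'I_n.-1) k = k' by rewrite -[k in LHS]/(val k') nth_ord_enum.
have stepE t : (k.+1 < size t)%N -> forall i0,
    nth 0 (steps y t) k = y (nth i0 t k) - y (nth i0 t k.+1).
  case: t => //= i t kt i0; rewrite (nth_pairmap i0)//.
have kn1 : (k.+1 < n)%N by lia.
rewrite (stepE _ _ (s (cur_idx k'))) ?szw//.
have nth_word (i : 'I_n) : nth (s (cur_idx k')) (word s) i = s i.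
  by rewrite (nth_map i) ?size_enum_ord// nth_ord_enum.
by rewrite (nth_word (cur_idx k')) (nth_word (next_idx k')).
Qed.

Lemma sorted_word (p : pred 'rV[R]_d) s :
  sorted (fun i j => p (y i - y j)) (word s) =
  [forall k, p (y (s (cur_idx k)) - y (s (next_idx k)))].
Proof.
rewrite sorted_steps steps_word all_map; apply/allP/forallP => h k.
  by apply: h; rewrite mem_enum.
by move=> _; exact: h.
Qed.

Lemma open_cellE s v : open_cell s v =
  (forall k, inner v (y (s (cur_idx k)) - y (s (next_idx k))) < 0) :> Prop.
Proof.
rewrite /open_cell/= (sorted_word (fun x => inner v x < 0)).
by apply/propext; split => [/forallP|] //; move=> h; apply/forallP.
Qed.

Lemma chamberE s v : chamber s v =
  (forall k, inner v (y (s (cur_idx k)) - y (s (next_idx k))) <= 0) :> Prop.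
Proof.
by apply/propext; split => h k; move: (h k); rewrite innerBr subr_le0.
Qed.

Lemma open_cell_chamber s : open_cell s `<=` chamber s.
Proof. by move=> v; rewrite open_cellE chamberE => h k; exact: ltW. Qed.

Lemma weyl_complementE v : weyl_complement y v =
  (forall i j, i != j -> inner v (y i - y j) != 0) :> Prop.
Proof.
apply/propext; split=> [h i j ij|h [[i j] /= ij]].
  apply/eqP => vij; apply: h; move: ij; rewrite neq_ltn => /orP[ij|ji].
    by exists (i, j).
  exists (j, i) => //=.
  by rewrite /perp/= -opprB -scaleN1r innerZr vij mulr0.
by apply/eqP/h; rewrite neq_ltn ij.
Qed.

Lemma below_sorted v t : sorted (below y v) t =
  sorted <%R [seq inner v (y i) | i <- t].
Proof.
by rewrite sorted_map; apply: eq_sorted => i j; rewrite /below innerBr subr_lt0.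
Qed.

(** Off the hyperplanes, sorting the numbers [inner v (y i)] places [v] in a
  cell; two cells are disjoint because a strict sorting is unique. *)
Lemma complement_cells : weyl_complement y = \bigcup_s open_cell s.
Proof.
apply/seteqP; split=> v; rewrite weyl_complementE.
  move=> vy; pose f i := inner v (y i).
  have f_inj : injective f.
    move=> i j /eqP; rewrite -subr_eq0 -innerBr => vij.
    by apply: contraTeq vij; exact: vy.
  have [s sE] : exists s, word s = sort (relpre f <=%R) (enum 'I_n).
    by apply: wordP; rewrite perm_sort.
  exists s => //; rewrite /open_cell/= below_sorted lt_sorted_uniq_le.
  rewrite map_inj_uniq// word_uniq sE sorted_map sort_sorted//.
  by move=> i j; exact: le_total.
move=> [s _] + i j ij; rewrite /open_cell/=; move: (mem_word s j).
case/splitPr: (mem_word s i) => t1 t2 + vs.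
move: vs; rewrite sorted_insert; last exact: below_trans.
case/and3P => _ /allP t1i /allP t2i; rewrite mem_cat inE eq_sym (negbTE ij)/=.
case/orP => [/t1i|/t2i]; rewrite /below => jk; last by rewrite lt_eqF.
by rewrite -opprB -scaleN1r innerZr mulN1r oppr_eq0 lt_eqF.
Qed.

End weyl_cones.

Section tessellation.
Context {R : realType} {d n : nat} (y : 'I_n -> 'rV[R]_d).
Implicit Types (u v w x : 'rV[R]_d) (s : 'S_n).

Lemma open_cell_inj s s' v : open_cell y s v -> open_cell y s' v -> s = s'.
Proof.
rewrite /open_cell/= => vs vs'; apply: word_inj.
apply: (irr_sorted_eq _ _ vs vs'); first exact: below_trans.
  by move=> i; rewrite /below innerBr subrr ltxx.
by move=> i; rewrite !mem_word.
Qed.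

Lemma open_cell_connected s : connected (open_cell y s).
Proof.
apply: convex_connected => u v c; rewrite !open_cellE => us vs /andP[c0 c1] k.
set x := _ - _; have := us k; have := vs k; rewrite -/x => vx ux.
have -> : u + c *: (v - u) = (1 - c) *: u + c *: v.
  by rewrite scalerBr scalerBl scale1r addrA addrAC.
rewrite innerDl !innerZl; have [->|cn1] := eqVneq c 1.
  by rewrite subrr mul0r add0r mul1r.
rewrite ltr_wnDr//; first by rewrite mulr_ge0_le0// ltW.
by rewrite pmulr_rlt0// subr_gt0 lt_neqAle cn1.
Qed.

(** A cell is convex, and no connected set leaves it within the complement: the
  inner product with a difference [y i - y j] would vanish on the way. *)
Lemma connected_component_cell s v : open_cell y s v ->
  connected_component (weyl_complement y) v = open_cell y s.
Proof.
move=> vs; apply/seteqP; split; last first.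
  apply: connected_component_max => //; last exact: open_cell_connected.
  by rewrite complement_cells => w ws; exists s.
move=> w [D [Dv DC cD] Dw]; rewrite open_cellE => k; set x := _ - _.
have vx : inner v x < 0 by move: vs; rewrite open_cellE; exact.
rewrite ltNge; apply/negP => wx.
have : is_interval ((inner ^~ x) @` D).
  apply/connected_intervalP/connected_continuous_connected => //.
  exact/continuous_subspaceT/inner_continuous.
have Dim z : D z -> ((inner ^~ x) @` D) (inner z x) by exists z.
move=> /(_ _ _ (Dim _ Dv) (Dim _ Dw) 0)[|z Dz zx]; first by rewrite (ltW vx).
have := DC _ Dz; rewrite weyl_complementE => /(_ (s (cur_idx k)) (s (next_idx k))).
rewrite (inj_eq perm_inj) -val_eqE/= neq_ltn ltnSn => /(_ isT).
by rewrite -/x zx eqxx.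
Qed.

Lemma closure_open_cell s v : open_cell y s v ->
  closure (open_cell y s) = chamber y s.
Proof.
move=> vs; apply/seteqP; split=> u.
  move=> us; rewrite chamberE => k; set x := _ - _; rewrite leNgt.
  apply/negP => ux.
  have [|w [ws wx]] := us (inner ^~ x @^-1` [set r | 0 < r]).
    apply: open_nbhs_nbhs; split => //; apply: open_comp; last exact: open_gt.
    by move=> ? _; exact: inner_continuous.
  by move: ws; rewrite open_cellE => /(_ k); rewrite ltNge ltW.
move=> us B /nbhs_ballP[r /= r0 rB].
pose e := r / (`|v| + 1); have e0 : 0 < e by rewrite divr_gt0// ltr_wpDl.
exists (u + e *: v); split; last first.
  apply: rB; rewrite -ball_normE/= opprD addNKr normrN normrZ gtr0_norm//.
  by rewrite /e mulrAC ltr_pdivrMr ?ltr_wpDl// ltr_pM2l// ltrDl.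
rewrite open_cellE => k; move: us vs; rewrite chamberE open_cellE.
by move=> /(_ k) us /(_ k) vs; rewrite innerDl innerZl ltr_wnDl// pmulr_rlt0.
Qed.

(** A point of the open cell of [s] that lies in another chamber lies in its
  open cell, being off all hyperplanes. *)
Lemma chamber_inj s s' : open_cell y s !=set0 -> chamber y s = chamber y s' ->
  s = s'.
Proof.
move=> [v vs] E.
apply: (open_cell_inj vs); have vC : weyl_complement y v.
  by rewrite complement_cells; exists s.
have : chamber y s' v by rewrite -E; exact: open_cell_chamber.
rewrite chamberE open_cellE => vs' k; rewrite lt_neqAle vs' andbT.
move: vC; rewrite weyl_complementE; apply.
by rewrite (inj_eq perm_inj) -val_eqE/= neq_ltn ltnSn.
Qed.

Lemma weyl_tessellationE : weyl_tessellation y =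
  chamber y @` [set s | open_cell y s !=set0].
Proof.
apply/seteqP; split=> [_ [v vC <-]|_ [s [v vs] <-]].
  have [s _ vs] : (\bigcup_s open_cell y s) v by rewrite -complement_cells.
  exists s; first by exists v.
  by rewrite -(closure_open_cell vs) (connected_component_cell vs).
exists v; first by rewrite complement_cells; exists s.
by rewrite -(closure_open_cell vs) (connected_component_cell vs).
Qed.

Definition cells : {set 'S_n} := [set s | `[< open_cell y s !=set0 >]]%SET.

Lemma cellsP s : reflect (open_cell y s !=set0) (s \in cells).
Proof. by rewrite inE; exact: asboolP. Qed.

Lemma tessellation_perm : finite_set (weyl_tessellation y) /\
  perm_eq (fset_set (weyl_tessellation y)) [seq chamber y s | s <- enum cells].
Proof.
have fin : finite_set (weyl_tessellation y).
  by rewrite weyl_tessellationE; exact/finite_image/finite_finset.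
split => //; apply: uniq_perm; first exact: fset_uniq.
  rewrite map_inj_in_uniq ?enum_uniq// => s s'.
  by rewrite mem_enum => /cellsP ss _; exact: chamber_inj.
move=> C; rewrite in_fset_set//; apply/idP/mapP.
  rewrite inE weyl_tessellationE => -[s ss <-]; exists s => //.
  by rewrite mem_enum; exact/cellsP.
move=> [s]; rewrite mem_enum inE weyl_tessellationE => /cellsP ss ->.
by exists s.
Qed.

Lemma card_weyl_tessellation : #|` fset_set (weyl_tessellation y)| = #|cells|.
Proof.
by have [_ /perm_size ->] := tessellation_perm; rewrite size_map cardE.
Qed.

Lemma sum_weyl_tessellation (f : set 'rV[R]_d -> R) :
  \sum_(C \in weyl_tessellation y) f C = \sum_(s in cells) f (chamber y s).
Proof.
have [fin pe] := tessellation_perm.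
by rewrite fsbig_finite// (perm_big _ pe) big_map big_enum.
Qed.

End tessellation.

Section general_position.
Context {R : realType} {d n : nat} (y : 'I_n -> 'rV[R]_d).
Hypothesis gp : typeA_general_position y.
Implicit Types (u v w x : 'rV[R]_d) (s : 'S_n).

(** Fewer than [d] differences are independent too, since they can be completed
  to [d] of them; this uses that there are at least [d.+1] points. *)
Lemma general_position_relative : general_relative y 0%VS (enum 'I_n).
Proof.
move=> t xs /wordP[s <-]; rewrite steps_word dimv0 !add0n add0v.
set f := fun k => _.
move=> /subseqP[m _ ->]; rewrite -map_mask; set ks := mask m _.
have [dn free_d] := gp.
have uks : uniq ks by rewrite mask_uniq// enum_uniq.
rewrite size_map => ksd; pose rest := [seq k <- enum 'I_n.-1 | k \notin ks].
pose K := [set k in take d (ks ++ rest)]%SET.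
have uall : uniq (ks ++ rest).
  rewrite cat_uniq uks filter_uniq ?enum_uniq// andbT.
  by apply/hasPn => k; rewrite mem_filter => /andP[].
have szall : size (ks ++ rest) = n.-1.
  rewrite -[RHS]card_ord -(card_uniqP uall); apply: eq_card => k.
  by rewrite mem_cat mem_filter mem_enum andbT inE; case: (k \in ks).
have Kperm : perm_eq (enum K) (take d (ks ++ rest)).
  apply: uniq_perm; rewrite ?enum_uniq ?take_uniq// => k.
  by rewrite mem_enum inE.
have /(free_d s) : #|K| = d.
  by rewrite cardE (perm_size Kperm) size_takel// szall; lia.
rewrite (perm_free (perm_map f Kperm)) take_cat ltnNge ksd/= map_cat.
by move=> /catl_free; rewrite /free size_map => /eqP.
Qed.

Lemma card_cells : #|cells y| = region_count d n.
Proof.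
have := num_inducedE (enum_uniq 'I_n) general_position_relative.
rewrite dimv0 subn0 size_enum_ord => <-.
have pe : perm_eq (permutations (enum 'I_n)) [seq word s | s <- enum 'S_n].
  apply: uniq_perm; first exact: permutations_uniq.
    by rewrite map_inj_uniq ?enum_uniq//; exact: word_inj.
  move=> t; rewrite mem_permutations; apply/idP/mapP => [/wordP[s <-]|[s _ ->]].
    by exists s; rewrite ?mem_enum.
  exact: word_perm.
rewrite /num_induced (perm_big _ pe) big_map big_enum/= -sum1_card big_mkcond/=.
apply: eq_bigr => s _; rewrite inE /induced; case: asboolP => [[v vs]|h].
  case: asboolP => // h; exfalso; apply: h; exists v => // u.
  by rewrite memv0 => /eqP ->; rewrite innerC inner0l.
case: asboolP => // -[v _ vs]; exfalso; apply: h; by exists v.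
Qed.

(** The sum of the coordinate forms along [xs], negated, is the form sought; it
  is the inner product with the row of its values on the canonical basis. *)
Lemma free_solution (xs : seq 'rV[R]_d) : free xs ->
  exists u, {in xs, forall x, inner u x = -1}.
Proof.
move=> fr; pose X := in_tuple xs.
pose phi x := - \sum_i coord X i x.
exists (\row_k phi (delta_mx 0 k)) => x /(nthP 0)[i ix <-].
have phiE z : inner (\row_k phi (delta_mx 0 k)) z = phi z.
  rewrite /inner /phi; under eq_bigr do rewrite mxE mulNr mulr_suml.
  rewrite sumrN exchange_big; congr (- _); apply: eq_bigr => j _ /=.
  rewrite [in RHS](row_sum_delta z) linear_sum/=; apply: eq_bigr => k _.
  by rewrite linearZ/= mulrC.
rewrite phiE /phi -[xs`_i]/(X`_(Ordinal ix)).
rewrite (bigD1 (Ordinal ix))// coord_free// eqxx big1 => [|j jx]; 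
    first by congr (- _); exact: addr0.
by rewrite coord_free// eq_sym (negbTE jx).
Qed.

Lemma orthogonal_span v (xs : seq 'rV[R]_d) :
  {in xs, forall x, inner v x = 0} -> {in <<xs>>%VS, forall x, inner v x = 0}.
Proof.
elim: xs => [_ x|a xs IH h x].
  by rewrite span_nil memv0 => /eqP ->; rewrite innerC inner0l.
rewrite span_cons addvC; apply: orthogonal_line; last by rewrite h ?mem_head.
by apply: IH => z zs; rewrite h// inE zs orbT.
Qed.

(** At a nonzero vector of the chamber fewer than [d] of the defining
  inequalities are tight, because [d] independent normals have no common nonzero
  orthogonal vector. The tight ones having independent normals, some [u]
  loosens them all at once. *)
Lemma chamber_nontrivial s : (0 < d)%N -> (chamber y s <> [set 0]) <-> (open_cell y s !=set0).
Proof.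
move=> d0; have [dn _] := gp; split=> [nt|[v vs] E]; last first.
  have : chamber y s v by exact: open_cell_chamber.
  rewrite E => /= v0; move: vs; rewrite v0 open_cellE.
  have n1 : (0 < n.-1)%N by lia.
  by move=> /(_ (Ordinal n1)); rewrite inner0l ltxx.
have [v vs v0] : exists2 v, chamber y s v & v != 0.
  apply: contrapT => h; apply: nt; apply/seteqP; split=> [v vs|_ ->].
    by apply: contrapT => /eqP v0; apply: h; exists v.
  by rewrite chamberE => k; rewrite inner0l.
pose xs := [seq x <- steps y (word s) | inner v x == 0].
have xs_sub : subseq xs (steps y (word s)) by exact: filter_subseq.
have [ltd|ged] := ltnP (size xs) d.
  have := general_position_relative (word_perm s) xs_sub.
  rewrite dimv0 !add0n add0v => /(_ (ltnW ltd)) /eqP fr.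
  have [u uxs] := free_solution fr.
  have [|e _ he] := @perturbation _ _ v u (steps y (word s)).
    move=> x xw; have [vx|vx] := eqVneq (inner v x) 0.
      by right; rewrite uxs ?ltrN10// mem_filter vx eqxx.
    left; rewrite lt_neqAle vx; move: xw; rewrite steps_word => /mapP[k _ ->].
    by move: vs; rewrite chamberE; exact.
  exists (v + e *: u); rewrite open_cellE => k; apply: he.
  by rewrite steps_word; apply: (map_f (fun k => _)); rewrite mem_enum.
have := general_position_relative (word_perm s) (subseq_trans (take_subseq _ d) xs_sub).
rewrite dimv0 !add0n add0v size_takel// => /(_ (leqnn d)) dimE.
have full : (<<take d xs>> = fullv)%VS.
  by apply/eqP; rewrite eqEdim subvf dimvf dimE/= /dim/= mul1n.
exfalso; move/negP: v0; apply; apply/eqP/rowP => k.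
rewrite -inner_delta mxE (@orthogonal_span _ (take d xs)) ?full ?memvf//.
by move=> x /mem_take; rewrite mem_filter => /andP[/eqP].
Qed.

End general_position.

(** * Cones meeting a compact set *)

Section rational_points.
Context {R : realType} {d : nat}.
Implicit Types (u v x : 'rV[R]_d) (q : 'rV[rat]_d).

Definition ratv q : 'rV[R]_d := map_mx ratr q.

Lemma ratv_dense v (e : R) : 0 < e -> exists q, `|v - ratv q| < e.
Proof.
move=> e0.
have /choice[f fP] (k : 'I_d) : exists r : rat, ratr r \in `](v 0 k - e), (v 0 k + e)[.
  by apply: rat_in_itvoo; rewrite ltrD2l -subr_gt0 opprK addr_gt0.
exists (\row_k f k); suff : ball v e (ratv (\row_k f k)) by rewrite -ball_normE.
split=> // i j; rewrite (ord1 i) /ball/= !mxE.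
by have := fP j; rewrite in_itv/= ltr_distlC.
Qed.

(** The topology of row vectors is that of the maximum norm, whereas cones are
  compared in the Euclidean norm. *)
Lemma enorm_le v : enorm v <= d%:R * `|v|.
Proof.
have vk k : `|v 0 k| <= `|v|.
  rewrite [leRHS]/Num.norm/= mx_normrE; apply: le_trans (le_bigmax _ _ (0, k)).
  by [].
rewrite -[leRHS]ger0_norm ?mulr_ge0// -sqrtr_sqr ler_wsqrtr// /inner.
apply: (@le_trans _ _ (\sum_(k < d) `|v| ^+ 2)).
  apply: ler_sum => k _; rewrite -expr2 -real_normK ?num_real//.
  by rewrite lerXn2r ?nnegrE.
rewrite sumr_const card_ord exprMn -[leLHS]mulr_natl ler_wpM2r ?sqr_ge0//.
by rewrite -natrX ler_nat; case: (d) => // m; rewrite leq_pmulr.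
Qed.

Lemma unit_ball_norm v : unit_ball v -> `|v| <= 1.
Proof.
rewrite /unit_ball/= /enorm => v1.
have {}v1 : inner v v <= 1.
  rewrite -[X in X <= _]sqr_sqrtr; last by apply: sumr_ge0 => k _; rewrite -expr2 sqr_ge0.
  by rewrite expr_le1// sqrtr_ge0.
rewrite [leLHS]/Num.norm/= mx_normrE; apply/bigmax_leP; split => // -[i k] _ /=.
rewrite (ord1 i) -(@expr_le1 _ 2)// real_normK ?num_real//.
apply: le_trans v1; rewrite /inner (bigD1 k)//= -expr2 lerDl.
by apply: sumr_ge0 => j _; rewrite -expr2 sqr_ge0.
Qed.

Lemma enorm_continuous : continuous (enorm : 'rV[R]_d -> R).
Proof.
move=> v; apply: (@continuous_comp _ _ _ (fun v => inner v v) Num.sqrt); last first.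
  exact: sqrt_continuous.
apply: (continuous_big (op := +%R)); first exact: add_continuous.
by move=> k _ w; apply: continuousM; exact: coord_continuous.
Qed.

Lemma closed_unit_ball : closed (unit_ball : set 'rV[R]_d).
Proof.
apply: (@preimage_closed _ _ enorm [set r | r <= 1]); last exact: closed_le.
by move=> v _; exact: enorm_continuous.
Qed.

Lemma unit_ball_compact (A : set 'rV[R]_d) : closed A -> A `<=` unit_ball ->
  compact A.
Proof.
move=> clA A1; apply: bounded_closed_compact => //.
exists 1; split => // M M1 v /A1 /unit_ball_norm v1.
exact: le_trans v1 (ltW M1).
Qed.

End rational_points.

Section hitting_sets.
Context {R : realType} {d p : nat} d0 (T : measurableType d0).
Variable a : 'I_p -> T -> 'rV[R]_d.
Hypothesis ma : forall v k, measurable_fun setT (fun w => inner v (a k w)).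
Implicit Types (v : 'rV[R]_d) (w : T).

Let violation v w : R := \sum_k Num.max 0 (inner v (a k w)).

Let violation_ge0 v w : 0 <= violation v w.
Proof. by apply: sumr_ge0 => k _; rewrite le_max lexx. Qed.

Let violation_eq0 v w : (violation v w == 0) = [forall k, inner v (a k w) <= 0].
Proof.
rewrite psumr_eq0; last by move=> k _; rewrite le_max lexx.
apply/allP/forallP => h k.
  by have := h k (mem_index_enum _); rewrite /= => /eqP/max_idPl.
by move=> _; apply/eqP/max_idPl.
Qed.

Let violation_continuous w : continuous (violation ^~ w).
Proof.
move=> v; apply: (continuous_big (op := +%R)); first exact: add_continuous.
move=> k _ u; apply: (@continuous_max R _ (cst 0) (inner ^~ (a k w))).
  exact: cst_continuous.
exact: inner_continuous.
Qed.

Let violation_measurable v : measurable_fun setT (violation v).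
Proof.
by apply: measurable_sum => k; exact: measurable_maxr.
Qed.

(** A random cone meets a compact set exactly when the total violation comes
  arbitrarily close to [0] on a countable dense subset of it, since the violation
  is continuous and attains its minimum; for a fixed point the violation is a
  measurable function. *)
Lemma measurable_hitting (K : set 'rV[R]_d) : compact K ->
  measurable [set w | exists2 v, K v & forall k, inner v (a k w) <= 0].
Proof.
move=> cK.
(* The points [pt i] that lie in [K] form a countable dense subset of [K]: one
  point is chosen in each rational ball that meets [K]. *)
pose near_q (i : 'rV[rat]_d * nat) := K `&` [set v | `|v - ratv i.1| < i.2.+1%:R^-1].
pose pt i := xget 0 (near_q i).
pose F m i := [set w | K (pt i) /\ violation (pt i) w < m.+1%:R^-1].
have -> : [set w | exists2 v, K v & forall k, inner v (a k w) <= 0] =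
    \bigcap_m \bigcup_i F m i.
  apply/seteqP; split=> [w [v Kv vC] m _|w Fw].
    have v0 : violation v w = 0 by apply/eqP; rewrite violation_eq0; exact/forallP.
    have m0 : 0 < m.+1%:R^-1 :> R by rewrite invr_gt0.
    have /cvgrPdist_lt/(_ _ m0)/nbhs_ballP[e /= e0 He] := @violation_continuous w v.
    have e20 : 0 < e / 2 by rewrite divr_gt0.
    have [k _ /(_ _ (leqnn k)) ke] := near_infty_natSinv_lt (PosNum e20).
    have [q qv] : exists q, `|v - ratv q| < k.+1%:R^-1 :> R.
      by apply: ratv_dense; rewrite invr_gt0.
    exists (q, k) => //; have : near_q (q, k) (pt (q, k)).
      by apply: (xgetPex 0 (P := near_q (q, k))); exists v.
    move=> [Kpt ptq]; split => //.
    have /He : ball v e (pt (q, k)).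
      rewrite -ball_normE/= (splitr e); apply: le_lt_trans (ler_distD (ratv q) _ _) _.
      by rewrite ltrD ?(lt_trans _ ke)// distrC.
    by rewrite /= v0 sub0r normrN ger0_norm.
  have [i _ [Ki _]] := Fw 0%N Logic.I.
  have [v0 v0K v0min] : exists2 c, c \in K &
      forall t, t \in K -> violation c w <= violation t w.
    apply: compact_EVT_min => //; first by exists (pt i).
    by apply: continuous_subspaceT; exact: violation_continuous.
  exists v0; first by rewrite inE in v0K.
  apply/forallP; rewrite -violation_eq0 eq_le violation_ge0 andbT leNgt.
  apply/negP => v0pos.
  have [m _ /(_ _ (leqnn m)) mv0] := near_infty_natSinv_lt (PosNum v0pos).
  have [j _ [Kj]] := Fw m Logic.I; rewrite ltNge => /negP; apply.
  by rewrite (le_trans (ltW mv0))//= v0min// inE.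
apply: bigcap_measurable => // m _.
apply: countable_bigcupT_measurable; first exact: countableP.
move=> i; have [Ki|nKi] := pselect (K (pt i)); last first.
  by rewrite (_ : F m i = set0)//; apply/seteqP; split=> // w [].
rewrite (_ : F m i = setT `&` violation (pt i) @^-1` `]-oo, m.+1%:R^-1[).
  by apply: violation_measurable => //; exact: measurable_itv.
by apply/seteqP; split=> w; rewrite /F/= in_itv/=; [move=> []|move=> [_ ?]].
Qed.

End hitting_sets.

(** * Borel sets of cones *)

Section cone_topology.
Context {R : realType} {d : nat}.
Implicit Types (u v : 'rV[R]_d) (C D : set 'rV[R]_d) (s : {fset 'rV[rat]_d}).

(** The finite rational set [s] approximates the trace of the cone on the unit
  ball in both directions. One inequality is strict and the other is not, so that
  each condition says whether the cone meets some compact set. *)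
Definition traced_by s (m : nat) C :=
  (forall v, C v -> unit_ball v -> exists2 q, q \in s & `|v - ratv q| < m.+1%:R^-1)
  /\ (forall q, q \in s ->
        exists2 v, C v /\ unit_ball v & `|v - ratv q| <= m.+1%:R^-1).

Lemma unit_ball0 : unit_ball (0 : 'rV[R]_d).
Proof. by rewrite /unit_ball/= /enorm inner0l sqrtr0. Qed.

Lemma polyhedral_cone0 C : polyhedral_cone C -> C 0.
Proof. by move=> [m [a ->]] i; rewrite inner0l. Qed.

Lemma polyhedral_cone_closed C : polyhedral_cone C -> closed C.
Proof.
move=> [m [a ->]].
rewrite (_ : [set v | _] = \bigcap_i [set v | inner v (a i) <= 0]); last first.
  by apply/seteqP; split=> v h i; [move=> _; exact: h|exact: h].
apply: closed_bigI => i _.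
apply: (@preimage_closed _ _ (inner ^~ (a i)) [set r | r <= 0]); last exact: closed_le.
by move=> v _; exact: inner_continuous.
Qed.

Lemma dist_to_le v A u : A u -> dist_to v A <= enorm (v - u).
Proof.
move=> Au; apply: ge_inf; last by exists u.
by exists 0 => _ [z _ <-]; exact: sqrtr_ge0.
Qed.

Lemma traced_cone_dist s m C D : polyhedral_cone C -> polyhedral_cone D ->
  traced_by s m C -> traced_by s m D -> cone_dist C D <= d%:R * (2 / m.+1%:R).
Proof.
move=> pC pD tC tD.
have bound C' D' : polyhedral_cone C' -> traced_by s m C' -> traced_by s m D' ->
    sup [set dist_to v (D' `&` unit_ball) | v in C' `&` unit_ball] <=
    d%:R * (2 / m.+1%:R).
  move=> pC' [tC' _] [_ tD']; apply: ge_sup.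
    exists (dist_to 0 (D' `&` unit_ball)), 0 => //.
    by split; [exact: polyhedral_cone0|exact: unit_ball0].
  move=> _ [v [C'v v1] <-]; have [q qs vq] := tC' v C'v v1.
  have [u [D'u u1] uq] := tD' q qs.
  apply: le_trans (dist_to_le _ (conj D'u u1)) _; apply: le_trans (enorm_le _) _.
  rewrite ler_wpM2l//; apply: le_trans (ler_distD (ratv q) _ _) _.
  by rewrite (distrC _ u) mulr_natl mulr2n lerD// ltW.
by rewrite /cone_dist /hausdorff_dist ge_max !bound.
Qed.

(** Compactness of the trace makes finitely many rational points suffice. *)
Lemma traced_by_exists m C : polyhedral_cone C -> exists s, traced_by s m C.
Proof.
move=> pC; have m0 : 0 < m.+1%:R^-1 :> R by rewrite invr_gt0.
have : compact (C `&` unit_ball).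
  apply: unit_ball_compact => //; apply: closedI; last exact: closed_unit_ball.
  exact: polyhedral_cone_closed.
rewrite compact_cover => /(_ _ [set q | exists2 v, C v /\ unit_ball v &
  `|v - ratv q| <= m.+1%:R^-1] (fun q => ball (ratv q) m.+1%:R^-1)).
case=> [q _||s sD scov].
- exact: ball_open.
- move=> v [Cv v1]; have [q vq] := ratv_dense v m0; exists q.
    by exists v => //; exact: ltW.
  by rewrite -ball_normE/= distrC.
exists s; split=> [v Cv v1|q /sD].
  by have [q qs] := scov v (conj Cv v1); rewrite -ball_normE/= distrC => ?; exists q.
by rewrite inE.
Qed.

(** The sets of cones [traced_by s m] form a countable network of the space of
  cones: an open set is the union of those it contains. *)
Lemma open_cones_network U C : open_cones U -> U C -> exists s m,
  traced_by s m C /\ (forall D, polyhedral_cone D -> traced_by s m D -> U D).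
Proof.
move=> [Upoly Uopen] UC; have [e e0 eU] := Uopen C UC.
have e1 : 0 < e / (2 * d%:R + 1) by rewrite divr_gt0// ltr_wpDl// mulr_ge0.
have [m _ /(_ _ (leqnn m)) me] := near_infty_natSinv_lt (PosNum e1).
have [s sC] := traced_by_exists m (Upoly C UC); exists s, m; split => // D pD sD.
apply: eU => //; apply: le_lt_trans (traced_cone_dist (Upoly C UC) pD sC sD) _.
move: me; rewrite /= ltr_pdivlMr ?ltr_wpDl ?mulr_ge0//; apply: le_lt_trans.
by rewrite mulrA mulrC (mulrC d%:R) ler_wpM2l ?invr_ge0// lerDl.
Qed.

End cone_topology.

Section measurable_cone.
Context {R : realType} {d p : nat} d0 (T : measurableType d0).
Variable a : 'I_p -> T -> 'rV[R]_d.
Hypothesis ma : forall v k, measurable_fun setT (fun w => inner v (a k w)).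

Let cone w := [set v | forall k, inner v (a k w) <= 0].

Let cone_poly w : polyhedral_cone (cone w).
Proof. by exists p, (a ^~ w). Qed.

Lemma measurable_traced_by s m : measurable [set w | traced_by s m (cone w)].
Proof.
pose far := unit_ball `&`
  ~` \bigcup_(q in [set` s]) ball (ratv q : 'rV[R]_d) m.+1%:R^-1.
pose close q := unit_ball `&`
  closed_ball_ Num.norm (ratv q : 'rV[R]_d) m.+1%:R^-1.
have cfar : compact far.
  apply: unit_ball_compact; last by move=> v [].
  apply: closedI; first exact: closed_unit_ball.
  by apply: open_closedC; apply: bigcup_open => q _; exact: ball_open.
have cclose q : compact (close q).
  apply: unit_ball_compact; last by move=> v [].
  apply: closedI; first exact: closed_unit_ball.
  exact: closed_closed_ball_.
pose hit K := [set w | exists2 v, K v & forall k, inner v (a k w) <= 0].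
rewrite (_ : [set w | _] = ~` hit far `&` \bigcap_(q in [set` s]) hit (close q)).
  apply: measurableI; first exact/measurableC/measurable_hitting.
  apply: fin_bigcap_measurable; first exact: finite_fset.
  by move=> q _; exact: measurable_hitting.
apply/seteqP; split=> w.
  move=> [h1 h2]; split=> [[v [v1 vfar] vC]|q /= /h2[v [vC v1] vq]].
    have [q qs vq] := h1 v vC v1; apply: vfar; exists q => //.
    by rewrite -ball_normE/= distrC.
  by exists v => //; split => //; rewrite /closed_ball_/= distrC.
move=> [h1 h2]; split=> [v vC v1|q qs].
  apply: contrapT => h; apply: h1; exists v => //; split => // -[q qs].
  by rewrite -ball_normE/= distrC => vq; apply: h; exists q.
have [v [v1 vq] vC] := h2 q qs; exists v => //.
by rewrite distrC.
Qed.

(** An open set of cones is a countable union of sets [traced_by s m], whose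
  preimages are measurable; the Borel sets follow by generation. *)
Lemma measurable_cone B : borel_cones B ->
  measurable [set w | B [set v | forall k, inner v (a k w) <= 0]].
Proof.
rewrite -/cone; pose G := [set B | B `<=` @polyhedral_cone R d /\
  measurable [set w | B (cone w)]].
suff : borel_cones (R := R) (d := d) `<=` G by move=> h /h [].
apply: smallest_sub.
  split.
  - by split=> //; exact: measurable0.
  - move=> A [_ mA]; split; first by move=> C [].
    rewrite (_ : [set w | _] = ~` [set w | A (cone w)]); first exact: measurableC.
    by apply/seteqP; split=> w; [case|split].
  - move=> F mF; split; first by move=> C [i _]; exact: (mF i).1.
    rewrite (_ : [set w | _] = \bigcup_i [set w | F i (cone w)]).
      by apply: bigcup_measurable => i _; exact: (mF i).2.
    by apply/seteqP; split=> w [i _ h]; exists i.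
move=> U oU; split; first exact: oU.1.
pose good (i : {fset 'rV[rat]_d} * nat) := forall D : set 'rV[R]_d,
  polyhedral_cone D -> traced_by i.1 i.2 D -> U D.
rewrite (_ : [set w | _] = \bigcup_i
   [set w | traced_by i.1 i.2 (cone w) /\ good i]).
  apply: countable_bigcupT_measurable; first exact: countableP.
  move=> i; have [gi|ngi] := pselect (good i); last first.
    by rewrite (_ : [set w | _] = set0)//; apply/seteqP; split=> // w [].
  rewrite (_ : [set w | _] = [set w | traced_by i.1 i.2 (cone w)]).
    exact: measurable_traced_by.
  by apply/seteqP; split=> w; [case|split].
apply/seteqP; split=> w.
  by move=> /(open_cones_network oU)[s [m [sm g]]]; exists (s, m).
by move=> [i _ [ti gi]]; exact: gi.
Qed.

End measurable_cone.

(** * Events on random cones *)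

Section null_sets.
Context d0 (T : measurableType d0) (R : realType) (mu : {measure set T -> \bar R}).
Local Open Scope ereal_scope.
Import HBNNSimple.

(** The integral of a nonnegative function, measurable or not, is a supremum
  over simple functions, and these may be set to [0] on a measurable null set.
  The generality matters because nothing is known about the tessellation outside
  the almost sure event of general position. *)
Lemma ge0_integral_eq_off_null (N : set T) (f g : T -> \bar R) :
  measurable N -> mu N = 0 -> (forall w, 0 <= f w) -> (forall w, 0 <= g w) ->
  (forall w, ~ N w -> f w = g w) -> \int[mu]_w f w = \int[mu]_w g w.
Proof.
move=> mN N0 f0 g0 fg.
have le f1 f2 : (forall w, 0 <= f1 w) -> (forall w, 0 <= f2 w) ->
    (forall w, ~ N w -> f1 w = f2 w) -> \int[mu]_w f1 w <= \int[mu]_w f2 w.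
  move=> f10 f20 f12; rewrite !ge0_integralTE//.
  apply: ge_ereal_sup => _ [h /= hf1 <-].
  have mNC := measurableC mN.
  apply: ereal_sup_ubound; exists (proj_nnsfun h mNC).
    move=> w; rewrite -mrestrict /patch; case: ifPn => [|_]; last exact: f20.
    by rewrite inE => /f12 <-; exact: hf1.
  have -> : sintegral mu h = \int[mu]_w (h w)%:E.
    by rewrite integral_nnsfun// patch_setT.
  rewrite -mrestrict -integral_nnsfun// [RHS](ge0_negligible_integral mN) ?setTD//.
    by apply/measurable_EFinP; exact: measurable_funTS.
  by move=> w _; rewrite lee_fin.
by apply/eqP; rewrite eq_le !le// => w /fg.
Qed.

End null_sets.

Section weyl_cone_events.
Context {R : realType} {d n : nat} d0 (T : measurableType d0).
Variable Y : 'I_n -> T -> borel_rV R d.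
Hypothesis mY : forall i, measurable_fun setT (Y i).

Let G w := weyl_coneG (fun i => Y i w : 'rV[R]_d).

Let diff (k : 'I_n.-1) w : 'rV[R]_d := Y (cur_idx k) w - Y (next_idx k) w.

Let GE w : G w = [set v | forall k, inner v (diff k w) <= 0].
Proof.
by apply/seteqP; split=> v h k; have := h k; rewrite innerBr subr_le0.
Qed.

Lemma measurable_inner (v : 'rV[R]_d) :
  measurable_fun (setT : set (borel_rV R d)) (inner v : 'rV[R]_d -> R).
Proof.
apply: (measurability _ (RGenOpens.measurableE R)).
move=> _ [_ [a [b ->] <-]]; rewrite setTI; apply: sub_sigma_algebra.
have -> : inner v = inner ^~ v by apply/funext => x; rewrite innerC.
apply: open_comp; last exact: interval_open.
by move=> x _; exact: inner_continuous.
Qed.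

Let mdiff v k : measurable_fun setT (fun w => inner v (diff k w)).
Proof.
rewrite (_ : (fun w => _) = (fun w => inner v (Y (cur_idx k) w : 'rV[R]_d)) \-
    (fun w => inner v (Y (next_idx k) w : 'rV[R]_d))).
  by apply: measurable_funB; exact: (measurableT_comp (measurable_inner v)).
by apply/funext => w; rewrite /diff innerBr.
Qed.

Lemma measurable_weyl_coneG B : borel_cones B -> measurable (G @^-1` B).
Proof.
move=> /(measurable_cone mdiff); congr measurable.
by apply/seteqP; split=> w; rewrite /preimage/= GE.
Qed.

(** A cone is nontrivial when it meets the unit sphere of the maximum norm, a
  compact set. *)
Lemma measurable_nontrivial : measurable [set w | G w <> [set 0]].
Proof.
pose S : set 'rV[R]_d := [set v | `|v| = 1].
have cS : compact S.
  apply: bounded_closed_compact.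
    by exists 1; split => // M M1 v /= ->; exact: ltW.
  apply: (@preimage_closed _ _ (Num.norm : 'rV[R]_d -> R) [set 1]).
    by move=> v _; exact: norm_continuous.
  exact: closed_eq.
have := measurable_hitting mdiff cS; congr measurable.
apply/seteqP; split=> w /=.
  move=> [v v1 vC] E; have : G w v by rewrite GE.
  by rewrite E /= => v0; move: v1; rewrite /S/= v0 normr0 => /eqP; rewrite eq_sym oner_eq0.
move=> nt; have [v vG v0] : exists2 v, G w v & v != 0.
  apply: contrapT => h; apply: nt; apply/seteqP; split=> [v vG|_ ->].
    by apply: contrapT => /eqP v0; apply: h; exists v.
  by rewrite GE => k; rewrite inner0l.
exists (`|v|^-1 *: v).
  by rewrite /S/= normrZ normfV normr_id mulVf// normr_eq0.
move=> k; rewrite innerZl mulr_ge0_le0// ?invr_ge0//.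
by move: vG; rewrite GE; exact.
Qed.

End weyl_cone_events.

(** * The law of the Weyl random cone *)

Section symmetrization.
Context d0 (T : measurableType d0) (R : realType) (P : probability T R).
Context {d n : nat} (Y : 'I_n -> {RV P >-> borel_rV R d}).
Hypothesis hexch : exchangeable Y.

Let permuted (s : 'S_n) w := joint (fun i => Y (s i)) w.

Let mpermuted s : measurable_fun setT (permuted s).
Proof.
apply/measurable_fun_tnthP => i.
rewrite (_ : _ \o _ = Y (s i)); first exact: measurable_funP.
by apply/funext => w; rewrite /= tnth_mktuple.
Qed.

(** By exchangeability all [n`!] terms have the same expectation. *)
Lemma integral_symmetrized (A : set (n.-tuple (borel_rV R d))) (c : R) :
  measurable A -> 0 <= c ->
  (\int[P]_w (c * \sum_(s : 'S_n) \1_A (permuted s w))%:E =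
   (c * n`!%:R)%:E * P (joint (fun i => Y i) @^-1` A))%E.
Proof.
move=> mA c0; have mE s : measurable (permuted s @^-1` A).
  by rewrite -[X in measurable X]setTI; exact: mpermuted.
under eq_integral do rewrite EFinM -sumEFin.
have mind s : measurable_fun setT (fun w => (\1_A (permuted s w))%:E : \bar R).
  rewrite (_ : (fun w => _) = EFin \o (\1_(permuted s @^-1` A) : T -> R)).
    by apply/measurable_EFinP; exact: measurable_indic.
  by apply/funext => w; rewrite /= !indicE.
rewrite ge0_integralZl_EFin//; last 2 first.
- by move=> w _; apply: sume_ge0 => s _; rewrite lee_fin.
- exact: emeasurable_sum.
rewrite ge0_integral_sum//.
rewrite (eq_bigr (fun=> P (joint (fun i => Y i) @^-1` A))) => [|s _]; last first.
  rewrite -(hexch s mA) -[X in _ = P X]setIT -integral_indic//.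
  exact: mE.
by rewrite big_const card_Sn iter_addr_0 EFinM -muleA mule_natl.
Qed.

End symmetrization.

Section weyl_random_cone.
Context d0 (T : measurableType d0) (R : realType) (P : probability T R).
Context {d n : nat} (Y : 'I_n -> {RV P >-> borel_rV R d}).
Hypothesis d_gt0 : (0 < d)%N.
Hypothesis hexch : exchangeable Y.
Hypothesis hgp : {ae P, forall w,
  typeA_general_position (fun i => Y i w : 'rV[R]_d)}.

Let G w := weyl_coneG (fun i => Y i w : 'rV[R]_d).

Let nontrivial : set T := [set w | G w <> [set 0]].

Definition nontrivial_in (B : set (set 'rV[R]_d)) :
    set (n.-tuple (borel_rV R d)) :=
  [set t | B (weyl_coneG (tnth t : 'I_n -> 'rV[R]_d)) /\
           weyl_coneG (tnth t : 'I_n -> 'rV[R]_d) <> [set 0]].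

Lemma measurable_nontrivial_in B : borel_cones B -> measurable (nontrivial_in B).
Proof.
move=> mB; pose X (i : 'I_n) (t : n.-tuple (borel_rV R d)) := tnth t i.
have mX i : measurable_fun setT (X i) by exact: measurable_tnth.
exact: measurableI (measurable_weyl_coneG mX mB) (measurable_nontrivial mX).
Qed.

Lemma joint_nontrivial_in B (s : 'S_n) w :
  nontrivial_in B (joint (fun i => Y (s i)) w) =
  (B (chamber (fun i => Y i w : 'rV[R]_d) s) /\
   chamber (fun i => Y i w : 'rV[R]_d) s <> [set 0]) :> Prop.
Proof.
rewrite /nontrivial_in/= /chamber.
suff -> : tnth (joint (fun i => Y (s i)) w) = fun i => Y (s i) w by [].
by apply/funext => i; rewrite tnth_mktuple.
Qed.

Lemma preimage_nontrivial_in B : joint (fun i => Y i) @^-1` nontrivial_in B =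
  G @^-1` B `&` nontrivial.
Proof.
apply/seteqP; split=> w; rewrite /preimage/nontrivial_in/= /G;
by rewrite (_ : tnth (joint _ w) = fun i => Y i w)//; apply/funext => i;
   rewrite tnth_mktuple.
Qed.

Let count : R := (region_count d n)%:R.

(** In general position the cones of the tessellation are listed without
  repetition by the permutations with a nontrivial chamber. *)
Lemma sum_cells B w : typeA_general_position (fun i => Y i w : 'rV[R]_d) ->
  \sum_(C \in weyl_tessellation (fun i => Y i w : 'rV[R]_d)) (\1_B C : R) =
  \sum_(s : 'S_n) \1_(nontrivial_in B) (joint (fun i => Y (s i)) w).
Proof.
move=> gp; rewrite sum_weyl_tessellation big_mkcond/=; apply: eq_bigr => s _.
have [iffl iffr] := chamber_nontrivial gp s d_gt0.
rewrite !indicE; case: ifPn => [/cellsP sc|/cellsP sc].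
  congr (nat_of_bool _)%:R; apply/idP/idP; rewrite !inE joint_nontrivial_in.
    by move=> Bs; split => //; exact: iffr.
  by case.
rewrite memNset// joint_nontrivial_in => -[_ /iffl]; exact: sc.
Qed.

(** The number of cones being almost surely constant, it comes out of the
  expectation. *)
Lemma weyl_random_cone_lawE B : measurable (nontrivial_in B) ->
  weyl_random_cone_law Y B =
  ((count^-1 * n`!%:R)%:E * P (G @^-1` B `&` nontrivial))%E.
Proof.
move=> mB; rewrite -preimage_nontrivial_in /weyl_random_cone_law unlock.
have [N [mN PN gpN]] := hgp.
rewrite -integral_symmetrized ?invr_ge0//.
apply: (ge0_integral_eq_off_null mN PN) => [w|w|w wN].
- rewrite lee_fin; apply: mulr_ge0; first by rewrite invr_ge0.
  by apply: fsumr_ge0 => C _; rewrite indicE.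
- by rewrite lee_fin mulr_ge0 ?invr_ge0// sumr_ge0.
have gp : typeA_general_position (fun i => Y i w : 'rV[R]_d).
  by apply: contrapT => ngp; apply: wN; exact: gpN.
by rewrite sum_cells// card_weyl_tessellation card_cells.
Qed.

Lemma count_neq0 : count != 0.
Proof.
rewrite pnatr_eq0 -lt0n; case: (d) d_gt0 => // m _.
exact: region_count_gt0.
Qed.

Lemma weyl_random_cone_lawT : weyl_random_cone_law Y setT = 1%E.
Proof.
have [N [mN PN gpN]] := hgp; rewrite /weyl_random_cone_law unlock.
rewrite -(probability_setT P) -[X in _ = P X]setIT -integral_indic//.
apply: (ge0_integral_eq_off_null mN PN) => [w|w|w wN].
- rewrite lee_fin; apply: mulr_ge0; first by rewrite invr_ge0.
  by apply: fsumr_ge0 => C _; rewrite indicE.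
- by rewrite lee_fin indicE.
have gp : typeA_general_position (fun i => Y i w : 'rV[R]_d).
  by apply: contrapT => ngp; apply: wN; exact: gpN.
rewrite sum_weyl_tessellation card_weyl_tessellation card_cells//.
rewrite (eq_bigr (fun=> 1)) => [|s _]; last by rewrite indicE in_setT.
by rewrite sumr_const card_cells// mulVf ?count_neq0// indicE in_setT.
Qed.

(** The formula for the law, applied to the set of all cones, whose probability
  is [1], determines the normalizing constant. *)
Lemma prob_nontrivial : P nontrivial = (count / n`!%:R)%:E.
Proof.
have n0 : n`!%:R != 0 :> R by rewrite pnatr_eq0 -lt0n fact_gt0.
have mT : measurable (nontrivial_in setT).
  rewrite (_ : nontrivial_in setT =
      [set t | weyl_coneG (tnth t : 'I_n -> 'rV[R]_d) <> [set 0]]).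
    apply: (@measurable_nontrivial _ _ _ _ _
      (fun (i : 'I_n) (t : n.-tuple (borel_rV R d)) => tnth t i)).
    by move=> i; exact: measurable_tnth.
  by apply/seteqP; split=> t; [case|split].
have := weyl_random_cone_lawE mT.
rewrite weyl_random_cone_lawT preimage_setT setTI => E.
rewrite -[RHS]mule1 E muleA -EFinM.
suff -> : count / n`!%:R * (count^-1 * n`!%:R) = 1 by rewrite mul1e.
by rewrite mulrACA mulfV ?count_neq0// mulVf// mulr1.
Qed.

Lemma cond_law_weyl_coneG B : borel_cones B ->
  cond_law P G nontrivial B = weyl_random_cone_law Y B.
Proof.
move=> mB; rewrite weyl_random_cone_lawE; last exact: measurable_nontrivial_in.
rewrite /cond_law prob_nontrivial inver mulf_eq0 invr_eq0.
rewrite (negbTE count_neq0) pnatr_eq0 -(negbK (_ == _)) -lt0n fact_gt0 /=.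
by rewrite invf_div mulrC muleC.
Qed.

End weyl_random_cone.

Theorem proposition1p12 (R : realType) (d n : nat) (hd : (2 <= d)%N)
    (disp : measure_display) (T : measurableType disp) (P : probability T R)
    (Y : 'I_n -> {RV P >-> borel_rV R d})
    (hexch : exchangeable Y)
    (hgp : {ae P, forall w,
       typeA_general_position (fun i => Y i w : 'rV[R]_d)}) :
  let G := fun w : T => weyl_coneG (fun i => Y i w : 'rV[R]_d) in
  let nontrivial := [set w | G w <> [set 0]] in
  forall B : set (set 'rV[R]_d), borel_cones B ->
    weyl_random_cone_law Y B = cond_law P G nontrivial B.
Proof.
move=> G nontrivial B mB; apply/esym/cond_law_weyl_coneG => //.
exact: ltnW.
Qed.
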